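(* Let $\mathbf{P}$ be a poset, a meet-semilattice, or a lattice. Let $W_1=\mathrm{Filt}(\mathbf{P})$, $W_\partial=\mathrm{Idl}(\mathbf{P})$, let $xIy$ iff $x\cap y=\emptyset$, let $\mathcal{G}(W_1)$ be the complete lattice of Galois stable sets of filters and $\alpha(a)=\{x\in\mathrm{Filt}(\mathbf{P})\mid a\in x\}$. Then the $\Delta_1$-completion $\alpha:\mathbf{P}\to\mathcal{G}(W_1)$ is compact, hence a canonical extension of $\mathbf{P}$.
   Context: A filter of a poset $\mathbf{P}$ is a downwards directed (nonempty) upset; an ideal is an upwards directed (nonempty) downset. $\mathrm{Filt}(\mathbf{P})$, $\mathrm{Idl}(\mathbf{P})$ are the sets of filters and ideals. Let $\perp$ be the complement of $I$, so $x\perp y$ iff $x\cap y\neq\emptyset$. For $A\subseteq W_1$ let $A'=\{y\in W_\partial\mid \forall x\in A\; x\perp y\}$ and for $B\subseteq W_\partial$ let $B'=\{x\in W_1\mid\forall y\in B\; x\perp y\}$. $A\subseteq W_1$ is Galois stable if $A=A''$; $\mathcal{G}(W_1)$ is the complete lattice of Galois stable subsets of $W_1$ ordered by inclusion. A completion of $\mathbf{P}$ is a complete lattice $\mathbf{C}$ with an order embedding $\alpha:\mathbf{P}\to\mathbf{C}$ preserving finite joins and meets existing in $\mathbf{P}$. It is a $\Delta_1$-completion if every element of $\mathbf{C}$ is a join of elements of the form $\bigwedge\alpha[x]$ ($x$ a filter of $\mathbf{P}$) and every element of $\mathbf{C}$ is a meet of elements of the form $\bigvee\alpha[y]$ ($y$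 an ideal of $\mathbf{P}$). A completion is compact if for any filter $x$ and any ideal $y$ of $\mathbf{P}$, $\bigwedge\alpha[x]\leq\bigvee\alpha[y]$ iff $x\cap y\neq\emptyset$. A canonical extension of $\mathbf{P}$ is a compact $\Delta_1$-completion of $\mathbf{P}$. *)

(* Defs.v *)
From HB Require Import structures.
From mathcomp Require Import all_boot all_order.
From mathcomp Require Import boolp classical_sets functions cardinality.

Set Implicit Arguments.
Unset Strict Implicit.
Unset Printing Implicit Defensive.

Import Order.TTheory.

(* Opened in this order so that [`&`] is the intersection of sets. *)
Local Open Scope order_scope.
Local Open Scope classical_set_scope.

Section FiltersIdeals.
Context {d : Order.disp_t} (P : porderType d).

Definition is_upset (x : set P) : Prop := forall a b, x a -> a <= b -> x b.

Definition is_downset (y : set P) : Prop := forall a b, y b -> a <= b -> y a.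

Definition down_directed (x : set P) : Prop :=
  forall a b, x a -> x b -> exists c, [/\ x c, c <= a & c <= b].

Definition up_directed (y : set P) : Prop :=
  forall a b, y a -> y b -> exists c, [/\ y c, a <= c & b <= c].

(* The improper filter, and likewise the improper ideal, is not excluded. *)
Definition is_filter : set (set P) :=
  [set x | [/\ x !=set0, is_upset x & down_directed x]].

Definition is_ideal : set (set P) :=
  [set y | [/\ y !=set0, is_downset y & up_directed y]].

Definition Filt : Type := set_type is_filter.

Definition Idl : Type := set_type is_ideal.

End FiltersIdeals.

Section GaloisStable.
Context {W1 Wd : Type} (I : W1 -> Wd -> Prop).

Definition perp (x : W1) (y : Wd) : Prop := ~ I x y.

Definition rpolar (A : set W1) : set Wd := [set y | forall x, A x -> perp x y].

Definition lpolar (B : set Wd) : set W1 := [set x | forall y, B y -> perp x y].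

Definition galois_stable : set (set W1) := [set A | A = lpolar (rpolar A)].

Record Galois : Type :=
  MkGalois { galois_set :> set W1; _ : galois_set \in galois_stable }.

HB.instance Definition _ := [isSub for galois_set].
HB.instance Definition _ := [Choice of Galois by <:].

(* The order inherited from [set W1] is inclusion. *)
HB.instance Definition _ :=
  [SubChoice_isSubPOrder of Galois by <: with set_display].

End GaloisStable.

(* Joins and meets are taken as the (at most one) elements of [supremums S] and
   [infimums S], rather than through the total functions [supremum] and
   [infimum] of the library, which take a default value on the empty set. *)
Definition complete_lattice {d : Order.disp_t} (C : porderType d) : Prop :=
  forall S : set C, supremums S !=set0 /\ infimums S !=set0.

Section Completions.
Context {dP dC : Order.disp_t} {P : porderType dP} {C : porderType dC}.
Implicit Type alpha : P -> C.

Definition order_embedding alpha : Prop :=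
  forall a b, (alpha a <= alpha b) = (a <= b).

(* The empty set is allowed, so existing bounds of P are preserved as well. *)
Definition preserves_finite_joins alpha : Prop :=
  forall (S : set P) (p : P),
    finite_set S -> supremums S p -> supremums (alpha @` S) (alpha p).

Definition preserves_finite_meets alpha : Prop :=
  forall (S : set P) (p : P),
    finite_set S -> infimums S p -> infimums (alpha @` S) (alpha p).

Definition completion alpha : Prop :=
  [/\ complete_lattice C, order_embedding alpha,
      preserves_finite_joins alpha & preserves_finite_meets alpha].

Definition filter_elements alpha : set C :=
  [set u | exists x : Filt P, infimums (alpha @` val x) u].

Definition ideal_elements alpha : set C :=
  [set v | exists y : Idl P, supremums (alpha @` val y) v].

Definition Delta1_completion alpha : Prop :=
  [/\ completion alpha,
      forall c : C, exists2 S, S `<=` filter_elements alpha & supremums S c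
    & forall c : C, exists2 S, S `<=` ideal_elements alpha & infimums S c].

(* The [u] and [v] below exist and are unique since C is complete. *)
Definition compact_completion alpha : Prop :=
  completion alpha /\
  forall (x : Filt P) (y : Idl P) (u v : C),
    infimums (alpha @` val x) u -> supremums (alpha @` val y) v ->
    (u <= v) <-> (val x `&` val y !=set0).

Definition canonical_extension alpha : Prop :=
  Delta1_completion alpha /\ compact_completion alpha.

End Completions.

Section Representation.
Context {d : Order.disp_t} (P : porderType d).

Definition disjointFI (x : Filt P) (y : Idl P) : Prop :=
  val x `&` val y = set0.

Definition alpha_set (a : P) : set (Filt P) := [set x | val x a].

Lemma perp_disjointFI (x : Filt P) (y : Idl P) :
  perp disjointFI x y <-> val x `&` val y !=set0.
Proof.
rewrite /perp /disjointFI; split=> [/eqP/set0P//|[p xyp] xy0].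
by move: xyp; rewrite xy0.
Qed.

Lemma is_filter_principal (a : P) : is_filter [set b | a <= b].
Proof.
split; first by exists a => /=.
- by move=> b c /= ab bc; apply: le_trans bc.
- by move=> b c /= ab ac; exists a.
Qed.

Lemma is_ideal_principal (a : P) : is_ideal [set b | b <= a].
Proof.
split; first by exists a => /=.
- by move=> b c /= ca bc; apply: le_trans ca.
- by move=> b c /= ba ca; exists a.
Qed.

Lemma alpha_stable (a : P) : galois_stable disjointFI (alpha_set a).
Proof.
rewrite /galois_stable /=; apply/seteqP; split=> [x ax y|x /= H]; first exact.
pose y : Idl P := SigSub (mem_set (is_ideal_principal a)).
have /perp_disjointFI[b [/= xb ba]] : perp disjointFI x y.
  apply: H => z az; apply/perp_disjointFI; exists a; split=> //=.
have [_ xup _] := set_mem (valP x).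
exact: xup xb ba.
Qed.

Definition alpha (a : P) : Galois disjointFI :=
  MkGalois (mem_set (alpha_stable a)).

End Representation.

(* Main.v *)
(** The infimum of [alpha @` x] is the set of filters containing [x], i.e. the
    polar of the ideals meeting [x], and the supremum of [alpha @` y] is the set
    of filters meeting [y], i.e. the polar of [{y}]. Both compactness and the two
    density conditions follow from these descriptions; directedness is what
    preserves the finite joins and meets. *)

Require Import Defs.
From mathcomp Require Import all_boot all_order.
From mathcomp Require Import boolp classical_sets functions cardinality.

Set Implicit Arguments.
Unset Strict Implicit.
Unset Printing Implicit Defensive.

Import Order.TTheory.

Local Open Scope order_scope.
Local Open Scope classical_set_scope.

Section Bounds.
Context {d : Order.disp_t} {T : porderType d}.

(** Induction on a list enumerating [S]: nonemptiness of [x] settles the empty list, and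
    directedness absorbs one further element at a time. *)
Lemma down_directed_finite (x S : set T) :
  x !=set0 -> down_directed x -> finite_set S -> S `<=` x ->
  exists2 c, x c & lbound S c.
Proof.
move=> [x0 xx0] xdir /finite_seqP[s ->] sx.
suff [c xc cs] : exists2 c, x c & {in s, forall a, c <= a} by exists c.
elim: s sx => [|a s IH] sx; first by exists x0.
have [|c xc cs] := IH; first by move=> b bs; apply: sx; rewrite /= inE bs orbT.
have [|e [xe ea ec]] := xdir a c _ xc; first by apply: sx; rewrite /= mem_head.
exists e => // b; rewrite inE => /orP[/eqP->//|/cs]; exact: le_trans.
Qed.

Lemma up_directed_finite (y S : set T) :
  y !=set0 -> up_directed y -> finite_set S -> S `<=` y ->
  exists2 c, y c & ubound S c.
Proof.
move=> [y0 yy0] ydir /finite_seqP[s ->] sy.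
suff [c yc cs] : exists2 c, y c & {in s, forall a, a <= c} by exists c.
elim: s sy => [|a s IH] sy; first by exists y0.
have [|c yc cs] := IH; first by move=> b bs; apply: sy; rewrite /= inE bs orbT.
have [|e [ye ae ce]] := ydir a c _ yc; first by apply: sy; rewrite /= mem_head.
exists e => // b; rewrite inE => /orP[/eqP->//|/cs bc]; exact: le_trans ce.
Qed.

End Bounds.

Section GaloisLattice.
Context {W1 Wd : Type} (I : W1 -> Wd -> Prop).
Implicit Types (A : set W1) (B : set Wd) (c e : Galois I).

Lemma lpolar_stable B : galois_stable I (lpolar I B).
Proof.
by apply/seteqP; split=> [x Bx y|x xB y By]; [exact|apply: xB => z; exact].
Qed.

Definition galois_lpolar B : Galois I := MkGalois (mem_set (lpolar_stable B)).

Lemma galois_leP c e : (c <= e) <-> (galois_set c `<=` galois_set e).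
Proof. by split=> [/subsetPset|/subsetPset]. Qed.

Lemma galoisP c : galois_set c = lpolar I (rpolar I c).
Proof. exact: set_mem (valP c). Qed.

Lemma galois_complete : complete_lattice (Galois I).
Proof.
move=> S; split.
(* The join is the Galois closure of the union. *)
- exists (galois_lpolar (rpolar I [set x | exists2 c, S c & galois_set c x])).
  split=> [c Sc|e eS].
    by apply/galois_leP => x cx y; apply; exists c.
  apply/galois_leP => x xS; rewrite galoisP => y ey.
  by apply: xS => z [c Sc cz]; apply: ey; move/galois_leP: (eS c Sc); exact.
(* The meet is the intersection, written as the polar of the union of the polars so that its
   stability is immediate. *)
- exists (galois_lpolar [set y | exists2 c, S c & rpolar I c y]).
  split=> [c Sc|e eS].
    by apply/galois_leP => x xS; rewrite galoisP => y cy; apply: xS; exists c.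
  apply/galois_leP => x ex y [c Sc]; apply.
  by move/galois_leP: (eS c Sc); exact.
Qed.

End GaloisLattice.

Section AlphaCompletion.
Context {d : Order.disp_t} (P : porderType d).
Implicit Types (x z : Filt P) (y : Idl P) (a b : P).
Local Notation I := (@disjointFI d P).
Local Notation alpha := (@alpha d P).

Definition principal_filter a : Filt P :=
  SigSub (mem_set (is_filter_principal a)).

Definition principal_ideal a : Idl P :=
  SigSub (mem_set (is_ideal_principal a)).

Lemma filtP x : is_filter (val x). Proof. exact: set_mem (valP x). Qed.

Lemma idlP y : is_ideal (val y). Proof. exact: set_mem (valP y). Qed.

(** Turns membership in an ideal into [perp], so that polars can be tested at single elements of
    [P]: a common element lies above [a], and [y] is closed downwards. *)
Lemma perp_principal_filter a y : perp I (principal_filter a) y <-> val y a.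
Proof.
split=> [/perp_disjointFI[b [/= ab yb]]|ya].
  by have [_ ydown _] := idlP y; apply: ydown ab.
by apply/perp_disjointFI; exists a; split=> //=.
Qed.

Lemma perp_principal_ideal x a : perp I x (principal_ideal a) <-> val x a.
Proof.
split=> [/perp_disjointFI[b [/= xb ba]]|xa].
  by have [_ xup _] := filtP x; apply: xup ba.
by apply/perp_disjointFI; exists a; split=> //=.
Qed.

(** The set of ideals is [rpolar I [set x]], so this is the Galois closure of the single point
    [x]. *)
Definition filter_element x : Galois I := galois_lpolar I [set y | perp I x y].

Definition ideal_element y : Galois I := galois_lpolar I [set y].

Lemma filter_elementP x z :
  galois_set (filter_element x) z <-> val x `<=` val z.
Proof.
split=> [xz a xa|xz y /= /perp_disjointFI[a [xa ya]]].
  (* The principal ideal of [a] meets [x], hence meets [z]. *)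
  by apply/perp_principal_ideal/xz/perp_principal_ideal.
by apply/perp_disjointFI; exists a; split=> //; exact: xz.
Qed.

Lemma ideal_elementP y x :
  galois_set (ideal_element y) x <-> val x `&` val y !=set0.
Proof.
split=> [xy|xy _ ->]; last exact/perp_disjointFI.
by apply/perp_disjointFI; exact: xy.
Qed.

Lemma infimums_filter x : infimums (alpha @` val x) (filter_element x).
Proof.
split=> [_ [a xa <-]|e ex].
  by apply/galois_leP => z /filter_elementP; exact.
apply/galois_leP => z ez; apply/filter_elementP => a xa.
by have /galois_leP := ex (alpha a) (imageP _ xa); exact.
Qed.

Lemma supremums_ideal y : supremums (alpha @` val y) (ideal_element y).
Proof.
split=> [_ [a ya <-]|e ey].
  by apply/galois_leP => z za; apply/ideal_elementP; exists a.
apply/galois_leP => z /ideal_elementP[a [za ya]].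
by have /galois_leP := ey (alpha a) (imageP _ ya); exact.
Qed.

Lemma alpha_embedding : order_embedding alpha.
Proof.
move=> a b; apply/idP/idP => [/galois_leP ab|ab].
  by have := ab (principal_filter a) (lexx a).
apply/galois_leP => x xa; have [_ xup _] := filtP x; exact: xup ab.
Qed.

(** By stability of an upper bound [e], it is enough that a filter containing [p] meets every ideal
    [y] in the polar of [e]. The principal filter of each [a] in [S] lies in [e], so [y] contains
    [S], hence an upper bound of [S], hence [p]. *)
Lemma alpha_finite_joins : preserves_finite_joins alpha.
Proof.
move=> S p finS [pS pmin]; split=> [_ [a Sa <-]|e eS].
  by rewrite alpha_embedding; exact: pS.
apply/galois_leP => x xp; rewrite galoisP => y ey.
have [y0 ydown ydir] := idlP y.
have Sy : S `<=` val y.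
  move=> a Sa; apply/perp_principal_filter/ey.
  by have /galois_leP := eS (alpha a) (imageP _ Sa); apply; exact: lexx.
have [c yc Sc] := up_directed_finite y0 ydir finS Sy.
by apply/perp_disjointFI; exists p; split=> //; apply: ydown yc (pmin _ Sc).
Qed.

(** A filter in a lower bound [e] contains [S], hence by directedness a lower bound of [S], which is
    below [p]. *)
Lemma alpha_finite_meets : preserves_finite_meets alpha.
Proof.
move=> S p finS [pS pmax]; split=> [_ [a Sa <-]|e eS].
  by rewrite alpha_embedding; exact: pS.
apply/galois_leP => x ex; have [x0 xup xdir] := filtP x.
have Sx : S `<=` val x.
  move=> a Sa.
  by have /galois_leP := eS (alpha a) (imageP _ Sa); exact.
have [c xc Sc] := down_directed_finite x0 xdir finS Sx.
exact: xup xc (pmax _ Sc).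
Qed.

Lemma alpha_completion : completion alpha.
Proof.
split; [exact: galois_complete|exact: alpha_embedding|
  exact: alpha_finite_joins|exact: alpha_finite_meets].
Qed.

Lemma alpha_compact : compact_completion alpha.
Proof.
split=> [|x y u v ux vy]; first exact: alpha_completion.
rewrite (is_subset1_infimums ux (infimums_filter x)).
rewrite (is_subset1_supremums vy (supremums_ideal y)).
split=> [/galois_leP xy|[a [xa ya]]].
  (* The inclusion is evaluated at [x], a point of its own closure. *)
  by apply/ideal_elementP/xy/filter_elementP.
apply/galois_leP => z /filter_elementP xz.
by apply/ideal_elementP; exists a; split=> //; exact: xz.
Qed.

Lemma alpha_join_dense (c : Galois I) :
  exists2 S, S `<=` filter_elements alpha & supremums S c.
Proof.
(* A stable set is the join of the closures of its points. *)
exists [set filter_element x | x in galois_set c].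
  by move=> _ [x _ <-]; exists x; exact: infimums_filter.
split=> [_ [x cx <-]|e ce].
  apply/galois_leP => z xz; rewrite galoisP => y cy; apply: xz; exact: cy.
apply/galois_leP => x cx.
have /galois_leP := ce (filter_element x) (imageP _ cx); apply.
exact/filter_elementP.
Qed.

Lemma alpha_meet_dense (c : Galois I) :
  exists2 S, S `<=` ideal_elements alpha & infimums S c.
Proof.
(* Stability of [c] makes it the intersection of the polars of the single ideals in [rpolar I c]. *)
exists [set ideal_element y | y in rpolar I c].
  by move=> _ [y _ <-]; exists y; exact: supremums_ideal.
split=> [_ [y cy <-]|e ec].
  by apply/galois_leP => x cx _ ->; exact: cy.
apply/galois_leP => x ex; rewrite galoisP => y cy.
by have /galois_leP /(_ x ex) := ec (ideal_element y) (imageP _ cy); exact.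
Qed.

End AlphaCompletion.

Theorem proposition3 (d : Order.disp_t) (P : porderType d) :
  compact_completion (@alpha d P) /\ canonical_extension (@alpha d P).
Proof.
split; first exact: alpha_compact.
split; last exact: alpha_compact.
split; first exact: alpha_completion.
- exact: alpha_join_dense.
- exact: alpha_meet_dense.
Qed.
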